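(* Let $\Gamma_g$ be the fundamental group of a closed orientable surface of genus $g\ge2$. For every $n>1$ there exists a normal subgroup $H_n$ of $\Gamma_g$, of finite index $f(n)$, which contains no nontrivial elements of word length smaller than $n$, and where $$f(n)=O\bigl(g^{O(n^2)}\bigr),$$ i.e. there are constants $A,B>0$ independent of $n$ with $f(n)\le A\,g^{Bn^2}$ for all $n>1$.
   Context: Word length is with respect to a fixed standard finite generating set of $\Gamma_g$. *)

(* Defs.v *)
From HB Require Import structures.
From mathcomp Require Import all_boot generic_quotient.
From mathcomp Require Import mathcomp_extra boolp classical_sets functions.
From mathcomp Require Import cardinality.

Set Implicit Arguments.
Unset Strict Implicit.
Unset Printing Implicit Defensive.

Local Open Scope group_scope.
Local Open Scope quotient_scope.

(* The closed orientable surface of genus g is taken with its standard cell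
   structure: one vertex, oriented edges a_i, b_i (i < g), and one 2-cell
   attached along [a_0,b_0]...[a_(g-1),b_(g-1)].  Its fundamental group is the
   group of edge loops up to combinatorial homotopy, that is
     < a_0, b_0, ..., a_(g-1), b_(g-1) | [a_0,b_0] ... [a_(g-1),b_(g-1)] >. *)

(* An edge (i, false) is a_i and (i, true) is b_i. *)
Definition edge (g : nat) : Type := ('I_g * bool)%type.
HB.instance Definition _ g := Finite.on (edge g).

(* In an oriented edge (e, s), the boolean s tells whether e is reversed. *)
Definition oedge (g : nat) : Type := (edge g * bool)%type.
HB.instance Definition _ g := Finite.on (oedge g).

Definition rev_oedge g (x : oedge g) : oedge g := (x.1, ~~ x.2).

Definition comm_word g (i : 'I_g) : seq (oedge g) :=
  [:: ((i, false), false); ((i, true), false);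
      ((i, false), true);  ((i, true), true)].

Definition cell_boundary (g : nat) : seq (oedge g) :=
  flatten [seq comm_word i | i <- enum 'I_g].

(* Every word is an edge loop, since there is only one vertex. *)
Inductive edge_homotopic g : seq (oedge g) -> seq (oedge g) -> Prop :=
| edge_homotopic_refl u : edge_homotopic u u
| edge_homotopic_sym u v : edge_homotopic u v -> edge_homotopic v u
| edge_homotopic_trans u v w :
    edge_homotopic u v -> edge_homotopic v w -> edge_homotopic u w
| edge_homotopic_backtrack u v x :
    edge_homotopic (u ++ [:: x; rev_oedge x] ++ v) (u ++ v)
| edge_homotopic_cell u v :
    edge_homotopic (u ++ cell_boundary g ++ v) (u ++ v).

Definition edge_homotopicb g (u v : seq (oedge g)) : bool :=
  `[< edge_homotopic u v >].

Lemma edge_homotopicb_equiv g : equiv_class_of (@edge_homotopicb g).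
Proof.
split=> [u|u v|v u w].
- by apply/asboolP; exact: edge_homotopic_refl.
- by apply/asboolP/asboolP => /edge_homotopic_sym.
- move=> /asboolP uv /asboolP vw; apply/asboolP.
  exact: edge_homotopic_trans vw.
Qed.

Canonical edge_homotopicb_equiv_rel g :=
  EquivRelPack (@edge_homotopicb_equiv g).

Definition surface_group (g : nat) : Type :=
  {eq_quot (@edge_homotopicb_equiv_rel g)}.

HB.instance Definition _ g := Choice.on (surface_group g).
HB.instance Definition _ g := EqQuotient.on (surface_group g).

Section SurfaceGroup.
Variable g : nat.
Implicit Types (u v w : seq (oedge g)) (x y z : surface_group g).

Definition rev_word u := rev (map (@rev_oedge g) u).

Definition sg_class u : surface_group g := \pi_(surface_group g) u.

Lemma sg_classP u v : sg_class u = sg_class v <-> edge_homotopic u v.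
Proof.
rewrite /sg_class; split=> [/eqP|uv].
  by rewrite piE => /asboolP.
by apply/eqP; rewrite piE; apply/asboolP.
Qed.

Lemma sg_class_surj x : sg_class (repr x) = x.
Proof. exact: reprK. Qed.

Lemma rev_oedgeK : involutive (@rev_oedge g).
Proof. by case=> e s; rewrite /rev_oedge /= negbK. Qed.

Lemma rev_word_cat u v : rev_word (u ++ v) = rev_word v ++ rev_word u.
Proof. by rewrite /rev_word map_cat rev_cat. Qed.

Lemma rev_wordK : involutive rev_word.
Proof.
by move=> u; rewrite /rev_word map_rev revK mapK //; exact: rev_oedgeK.
Qed.

Lemma edge_homotopic_ctx s t u v :
  edge_homotopic u v -> edge_homotopic (s ++ u ++ t) (s ++ v ++ t).
Proof.
elim=> {u v} [u|u v _|u v w _ uv _|u v x|u v].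
- exact: edge_homotopic_refl.
- exact: edge_homotopic_sym.
- exact: edge_homotopic_trans uv.
- have := edge_homotopic_backtrack (s ++ u) (v ++ t) x.
  by rewrite -!catA.
- have := edge_homotopic_cell (s ++ u) (v ++ t).
  by rewrite -!catA.
Qed.

Lemma edge_homotopic_cat u u' v v' : edge_homotopic u u' ->
  edge_homotopic v v' -> edge_homotopic (u ++ v) (u' ++ v').
Proof.
move=> uu' vv'; apply: (@edge_homotopic_trans _ _ (u' ++ v)).
  exact: (@edge_homotopic_ctx [::] v).
by have := @edge_homotopic_ctx u' [::] _ _ vv'; rewrite !cats0.
Qed.

Lemma edge_homotopic_revr u : edge_homotopic (u ++ rev_word u) [::].
Proof.
elim/last_ind: u => [|u x IHu]; first exact: edge_homotopic_refl.
rewrite -cats1 rev_word_cat -catA.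
have -> : [:: x] ++ rev_word [:: x] ++ rev_word u
  = [:: x; rev_oedge x] ++ rev_word u by [].
exact: edge_homotopic_trans (edge_homotopic_backtrack _ _ _) IHu.
Qed.

Lemma edge_homotopic_revl u : edge_homotopic (rev_word u ++ u) [::].
Proof. by have := edge_homotopic_revr (rev_word u); rewrite rev_wordK. Qed.

Lemma edge_homotopic_rev u v :
  edge_homotopic u v -> edge_homotopic (rev_word u) (rev_word v).
Proof.
move=> uv; apply: (@edge_homotopic_trans _ _ (rev_word u ++ v ++ rev_word v)).
  apply: edge_homotopic_sym; rewrite -[X in edge_homotopic _ X]cats0.
  apply: edge_homotopic_cat; first exact: edge_homotopic_refl.
  exact: edge_homotopic_revr.
apply: (@edge_homotopic_trans _ _ (rev_word u ++ u ++ rev_word v)).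
  by apply: edge_homotopic_ctx; exact: edge_homotopic_sym.
rewrite catA -[X in edge_homotopic _ X]cat0s.
by apply: edge_homotopic_cat;
  [exact: edge_homotopic_revl | exact: edge_homotopic_refl].
Qed.

Definition sg_mul x y : surface_group g := sg_class (repr x ++ repr y).
Definition sg_one : surface_group g := sg_class [::].
Definition sg_inv x : surface_group g := sg_class (rev_word (repr x)).

Lemma edge_homotopic_repr u : edge_homotopic (repr (sg_class u)) u.
Proof. by apply/sg_classP; exact: sg_class_surj. Qed.

Lemma sg_mulE u v : sg_mul (sg_class u) (sg_class v) = sg_class (u ++ v).
Proof.
by apply/sg_classP; apply: edge_homotopic_cat; exact: edge_homotopic_repr.
Qed.

Lemma sg_invE u : sg_inv (sg_class u) = sg_class (rev_word u).
Proof. by apply/sg_classP/edge_homotopic_rev/edge_homotopic_repr. Qed.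

Lemma sg_mulA : associative sg_mul.
Proof.
move=> x y z; rewrite -(sg_class_surj x) -(sg_class_surj y).
by rewrite -(sg_class_surj z) !sg_mulE catA.
Qed.

Lemma sg_mul1x : left_id sg_one sg_mul.
Proof. by move=> x; rewrite -(sg_class_surj x) sg_mulE. Qed.

Lemma sg_mulx1 : right_id sg_one sg_mul.
Proof. by move=> x; rewrite -(sg_class_surj x) sg_mulE cats0. Qed.

Lemma sg_mulVx : left_inverse sg_one sg_inv sg_mul.
Proof.
move=> x; rewrite -(sg_class_surj x) sg_invE sg_mulE.
by apply/sg_classP; exact: edge_homotopic_revl.
Qed.

Lemma sg_mulxV : right_inverse sg_one sg_inv sg_mul.
Proof.
move=> x; rewrite -(sg_class_surj x) sg_invE sg_mulE.
by apply/sg_classP; exact: edge_homotopic_revr.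
Qed.

HB.instance Definition _ := isGroup.Build (surface_group g)
  sg_mulA sg_mul1x sg_mulx1 sg_mulVx sg_mulxV.

Definition sg_gen (e : edge g) : surface_group g := sg_class [:: (e, false)].

Definition word_eval u : surface_group g :=
  \prod_(x <- u) (if x.2 then (sg_gen x.1)^-1 else sg_gen x.1).

Lemma word_evalE u : word_eval u = sg_class u.
Proof.
rewrite /word_eval; elim: u => [|[e s] u IHu]; first by rewrite big_nil.
rewrite big_cons IHu /=; case: s => /=.
  by rewrite [(sg_gen e)^-1]sg_invE; exact: sg_mulE.
exact: sg_mulE.
Qed.

Lemma word_eval_ex x :
  exists k, `[< exists2 u, size u = k & word_eval u = x >].
Proof.
exists (size (repr x)); apply/asboolP; exists (repr x) => //.
by rewrite word_evalE sg_class_surj.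
Qed.

Definition word_length x : nat := ex_minn (word_eval_ex x).

End SurfaceGroup.

Definition normal_subgroup (G : groupType) (H : {pred G}) : Prop :=
  group_closed H /\ {in H, forall x y, x ^ y \in H}.

Definition left_cosets (G : groupType) (H : {pred G}) : set (set G) :=
  [set [set x * h | h in [set` H]]%classic | x in [set: G]]%classic.

Definition index_eq (G : groupType) (H : {pred G}) (m : nat) : Prop :=
  (left_cosets H #= `I_m)%card.

(* Main.v *)
(* A faithful linear representation gives the bound.  First, Gamma_g embeds in
   Gamma_2 as the fundamental group of the (g-1)-fold cyclic cover; injectivity
   is seen by letting Gamma_2 act on the cosets of the image.  Next, Gamma_2 is
   the double of the free group on two generators along their commutator.  The
   matrices P = [[2,-1],[-1,1]] and Q = [[2,1],[1,1]] generate a free group in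
   which the stabiliser of infinity is generated by PQP^-1Q^-1 = [[-1,6],[0,-1]]
   (ping-pong on the four arcs cut out by -1, 0, 1, infinity).  Conjugating the
   second free factor by the commuting shear [[1,t],[0,1]] represents Gamma_2
   over Z[t], and a ping-pong for the degree in t shows that it is faithful.
   Words of length less than n then give matrices whose entries have degree
   O(n) and coefficients exp(O(n)).  Specialising t to an integer larger than
   these coefficients and reducing modulo an integer larger than the resulting
   entries, hence of size exp(O(n^2)), keeps the nontrivial ones nontrivial. *)
From HB Require Import structures.
Require Import Defs.
From mathcomp Require Import all_boot all_order all_algebra.
From mathcomp Require Import boolp classical_sets functions cardinality.
From mathcomp Require Import reals exp.
From mathcomp Require Import zify ring lra.

Set Implicit Arguments.
Unset Strict Implicit.
Unset Printing Implicit Defensive.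

Import Order.TTheory GRing.Theory Num.Theory.

(** * Surface groups and cyclic covers *)

Lemma foldl_homotopic g (T : Type) (act : T -> oedge g -> T) u v p :
    (forall p x, act (act p x) (rev_oedge x) = p) ->
    (forall p, foldl act p (cell_boundary g) = p) ->
  edge_homotopic u v -> foldl act p u = foldl act p v.
Proof.
move=> actK act_cell uv.
elim: uv p => {u v} [u|u v _ IH|u v w _ IH1 _ IH2|u v x|u v] p //.
- by rewrite IH1.
- by rewrite !foldl_cat /= actK.
- by rewrite !foldl_cat act_cell.
Qed.

Lemma prodr_homotopic g (R : pzRingType) (r : oedge g -> R) u v :
    (forall x, r x * r (rev_oedge x) = 1)%R ->
    (\prod_(x <- cell_boundary g) r x = 1)%R ->
  edge_homotopic u v -> (\prod_(x <- u) r x = \prod_(x <- v) r x)%R.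
Proof.
move=> rK r_cell.
elim=> {u v} [u|u v _ IH|u v w _ IH1 _ IH2|u v x|u v] //.
- by rewrite IH1.
- by rewrite !big_cat /= !big_cons big_nil mulr1 rK mul1r.
- by rewrite !big_cat /= r_cell mul1r.
Qed.

Lemma flatten_homotopic g h (phi : oedge g -> seq (oedge h)) u v :
    (forall x, phi (rev_oedge x) = rev_word (phi x)) ->
    edge_homotopic (flatten (map phi (cell_boundary g))) [::] ->
  edge_homotopic u v ->
  edge_homotopic (flatten (map phi u)) (flatten (map phi v)).
Proof.
move=> phiV phi_cell.
elim=> {u v} [u|u v _ IH|u v w _ IH1 _ IH2|u v x|u v].
- exact: edge_homotopic_refl.
- exact: edge_homotopic_sym.
- exact: edge_homotopic_trans IH2.
- rewrite !map_cat !flatten_cat /= cats0 phiV.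
  exact: edge_homotopic_ctx (edge_homotopic_revr _).
- by rewrite !map_cat !flatten_cat; exact: edge_homotopic_ctx phi_cell.
Qed.

Lemma cell_boundaryS g :
  cell_boundary g.+1 = comm_word ord0 ++
    flatten [seq comm_word (lift ord0 j) | j <- enum 'I_g].
Proof. by rewrite /cell_boundary enum_ordSl /= -map_comp. Qed.

Lemma cell_boundary2 : cell_boundary 2 = comm_word ord0 ++ comm_word ord_max.
Proof.
rewrite cell_boundaryS enum_ordSl (size0nil (size_enum_ord 0)) /=.
by congr [:: _, _, _, _ & _]; congr (comm_word _); exact: val_inj.
Qed.

Lemma sg_class_cat g (u v : seq (oedge g)) :
  sg_class (u ++ v) = (sg_class u * sg_class v)%g.
Proof. exact: esym (sg_mulE u v). Qed.

Lemma sg_class_nil g : sg_class [::] = 1%g :> surface_group g.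
Proof. by []. Qed.

Lemma sg_class_rev g (u : seq (oedge g)) :
  sg_class (rev_word u) = (sg_class u)^-1%g.
Proof. exact: esym (sg_invE u). Qed.

Lemma sg_class_cell g : sg_class (cell_boundary g) = 1%g.
Proof.
apply/sg_classP; have := edge_homotopic_cell [::] [::] (g := g).
by rewrite cats0.
Qed.

Definition sg_letter g (x : oedge g) : surface_group g :=
  if x.2 then (sg_gen x.1)^-1%g else sg_gen x.1.

Lemma sg_classE g (u : seq (oedge g)) :
  sg_class u = (\prod_(x <- u) sg_letter x)%g.
Proof. exact/esym/word_evalE. Qed.

Lemma sg_letterV g (x : oedge g) : sg_letter (rev_oedge x) = (sg_letter x)^-1%g.
Proof. by case: x => e [] /=; rewrite /sg_letter /= ?invgK. Qed.

Local Notation "''a_' i" := (sg_gen (i, false)) (at level 0, i at level 0).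
Local Notation "''b_' i" := (sg_gen (i, true)) (at level 0, i at level 0).

Lemma sg_class_comm g (i : 'I_g) :
  sg_class (comm_word i) = ('a_i * 'b_i * 'a_i^-1 * 'b_i^-1)%g.
Proof. by rewrite sg_classE !big_cons big_nil mulg1 !mulgA. Qed.

Section CyclicCover.
Variable m : nat.

(* [a_0, b_0] go to [a^(m+1), b], and [a_(j+1), b_(j+1)] to the conjugates of
   [c, d] by [a^j], where [a, b, c, d] are the generators of the genus two
   group. *)
Definition cover_gen (e : edge m.+2) : seq (oedge 2) :=
  let a : oedge 2 := ((ord0, false), false) in
  match unlift ord0 e.1 with
  | None => if e.2 then [:: ((ord0, true), false)] else nseq m.+1 a
  | Some j => nseq j a ++ ((ord_max, e.2), false) :: nseq j (rev_oedge a)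
  end.

Definition cover_letter (x : oedge m.+2) : seq (oedge 2) :=
  if x.2 then rev_word (cover_gen x.1) else cover_gen x.1.

Definition cover_word (u : seq (oedge m.+2)) := flatten (map cover_letter u).

Lemma cover_letterV x : cover_letter (rev_oedge x) = rev_word (cover_letter x).
Proof. by case: x => e [] //=; rewrite /cover_letter /= rev_wordK. Qed.

Lemma sg_class_nseq g k (x : oedge g) :
  sg_class (nseq k x) = (sg_letter x ^+ k)%g.
Proof. by rewrite sg_classE big_nseq iter_mulg_1. Qed.

Lemma cover_gen0 b : sg_class (cover_gen (ord0, b)) =
  if b then 'b_ord0 else ('a_ord0 ^+ m.+1)%g.
Proof.
rewrite /cover_gen unlift_none; case: b => //.
exact: (sg_class_nseq m.+1 (_, false)).
Qed.

Lemma cover_genS (j : 'I_m.+1) b : sg_class (cover_gen (lift ord0 j, b)) =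
  ('a_ord0 ^+ j * sg_gen (ord_max, b) * 'a_ord0 ^- j)%g.
Proof.
rewrite /cover_gen /= liftK sg_class_cat -cat1s sg_class_cat !sg_class_nseq.
by rewrite sg_letterV expVgn mulgA.
Qed.

Lemma sg2_relation : ('a_ord0 * 'b_ord0 * 'a_ord0^-1 * 'b_ord0^-1 *
  ('a_ord_max * 'b_ord_max * 'a_ord_max^-1 * 'b_ord_max^-1) = 1
  :> surface_group 2)%g.
Proof.
by rewrite -!sg_class_comm -sg_class_cat -cell_boundary2 sg_class_cell.
Qed.

Lemma sg_class_cover u : sg_class (cover_word u) =
  (\prod_(x <- u) if x.2 then (sg_class (cover_gen x.1))^-1
                         else sg_class (cover_gen x.1))%g.
Proof.
elim: u => [|x u IH]; first by rewrite big_nil.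
rewrite /cover_word /= sg_class_cat IH big_cons /cover_letter.
by case: x.2; rewrite ?sg_class_rev.
Qed.

Lemma conj_comm (G : groupType) (x a b : G) :
  ((x * a * x^-1) * ((x * b * x^-1) * ((x * a * x^-1)^-1 * (x * b * x^-1)^-1))
   = x * (a * b * a^-1 * b^-1) * x^-1)%g.
Proof. by rewrite !invgM !invgK !mulgA !mulgVK. Qed.

(** The relation reads [a b a^-1 = w^-1 b]; repeated conjugation by [a] collects the factors
    [a^j w a^-j]. This yields the surface relation of the cyclic cover. *)
Lemma expg_conj_prod (G : groupType) (a b w : G) k :
    (a * b * a^-1 * b^-1 * w = 1 ->
  a ^+ k * b * a ^- k =
    (\prod_(0 <= j < k) (a ^+ j * w * a ^- j))^-1 * b)%g.
Proof.
move=> rel; elim: k => [|k IH].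
  by rewrite big_nil expg0 !invg1 !mul1g mulg1.
have ab : (a * b * a^-1 = w^-1 * b)%g.
  apply: (mulIg b^-1%g); rewrite mulgK; apply: (mulIg w).
  by rewrite mulVg.
rewrite big_nat_recr //= expgSr !invgM !invgK -!mulgA; congr (_ * _)%g.
by rewrite -IH !mulgA mulgVK -[RHS]mulgA ab mulgA.
Qed.

Lemma cover_cell : edge_homotopic (cover_word (cell_boundary m.+2)) [::].
Proof.
apply/sg_classP; rewrite sg_class_nil sg_class_cover cell_boundaryS big_cat.
rewrite big_flatten big_map /= !big_cons big_nil /= !cover_gen0 mulg1.
set a : surface_group 2 := 'a_ord0; set b : surface_group 2 := 'b_ord0.
have := expg_conj_prod m.+1 sg2_relation; rewrite -/a -/b.
set w := (_ * _ * _^-1 * _^-1)%g => rel.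
under eq_bigr => j _ do
  rewrite !big_cons big_nil /= !cover_genS mulg1 -/a conj_comm -/w.
rewrite -(big_map val predT (fun j => a ^+ j * w * a ^- j)%g) val_enum_ord.
rewrite /index_iota subn0 in rel; by rewrite !mulgA rel mulgK mulVg.
Qed.

Lemma cover_word_homotopic u v :
  edge_homotopic u v -> edge_homotopic (cover_word u) (cover_word v).
Proof.
apply: flatten_homotopic; [exact: cover_letterV | exact: cover_cell].
Qed.

(** * Injectivity of the covering map through an action on cosets *)

Let w (j : 'I_m.+1) : surface_group m.+2 := sg_class (comm_word (lift ord0 j)).

(* This is the element of the covering group that maps to [a^k b a^-k]. *)
Let ladder (k : nat) : surface_group m.+2 :=
  ((\prod_(j <- take k (enum 'I_m.+1)) w j)^-1 * 'b_ord0)%g.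

(* The coset [K a^i] of the image [K] of the covering group is encoded by [i],
   and the element [k a^i] by the pair [(k, i)]. *)
Definition coset_act (p : surface_group m.+2 * 'I_m.+1) (x : oedge 2) :=
  let: (k, i) := p in
  match x with
  | ((j, b), s) =>
    if j == ord0 then
      if b then ((k * (if s then (ladder i)^-1 else ladder i))%g, i)
      else if s then
        ((if i == ord0 then k * 'a_ord0^-1 else k)%g, ord_pred i)
      else ((if i == ord_max then k * 'a_ord0 else k)%g, ordS i)
    else ((k * sg_letter ((lift ord0 i, b), s))%g, i)
  end.

Lemma ordS_eq0 (i : 'I_m.+1) : (ordS i == ord0) = (i == ord_max).
Proof.
have [->|i_neq] := eqVneq i ord_max.
  by apply/eqP/val_inj; rewrite /= modnn.
have lt_i : i < m by rewrite ltn_neqAle -ltnS ltn_ord andbT.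
by apply/negP => /eqP/(congr1 val); rewrite /= modn_small.
Qed.

Lemma ladderS (i : 'I_m.+1) : ladder i.+1 = ((w i)^-1 * ladder i)%g.
Proof.
rewrite /ladder (take_nth i) ?size_enum_ord // nth_ord_enum.
by rewrite -cats1 big_cat big_seq1 invgM mulgA.
Qed.

Lemma ladder0 : ladder 0 = 'b_ord0.
Proof. by rewrite /ladder take0 big_nil invg1 mul1g. Qed.

(** The surface relation makes the product of all [w j] inverse to the commutator of [a_0] and
    [b_0]. This is what keeps the action consistent when the level wraps around. *)
Lemma ladder_max : ladder m.+1 = ('a_ord0 * 'b_ord0 * 'a_ord0^-1)%g.
Proof.
have := sg_class_cell m.+2; rewrite cell_boundaryS sg_class_cat sg_class_comm.
have -> : sg_class (flatten [seq comm_word (lift ord0 j) | j <- enum 'I_m.+1])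
  = (\prod_(j <- enum 'I_m.+1) w j)%g.
  elim: (enum _) => [|j s IH]; first by rewrite big_nil.
  by rewrite big_cons -IH -sg_class_cat.
rewrite /ladder take_oversize ?size_enum_ord // => /mulg1_eq <-.
by rewrite invgK mulgVK.
Qed.

Lemma coset_actK p x : coset_act (coset_act p x) (rev_oedge x) = p.
Proof.
case: p x => k i [[j b] s] /=; case j0: (j == ord0); last first.
  by case: s; rewrite /= j0 /sg_letter /= ?mulgK ?mulgVK.
case: b; first by case: s; rewrite /= j0 ?mulgK ?mulgVK.
case: s => /=; rewrite j0 ?ord_predK ?ordSK.
  by rewrite -ordS_eq0 ord_predK; case: (i == ord0); rewrite ?mulgVK.
by rewrite ordS_eq0; case: (i == ord_max); rewrite ?mulgK.
Qed.

(** From level [i], the first handle contributes [ladder i.+1] times the inverse of [ladder i],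
    which is the inverse of [w i]; the second handle contributes [w i]. *)
Lemma coset_act_cell p : foldl coset_act p (cell_boundary 2) = p.
Proof.
case: p => k i; rewrite cell_boundary2 foldl_cat /= ordSK ordS_eq0.
rewrite -/(sg_letter (lift ord0 i, false, false)) /=.
have wE : w i = ('a_(lift ord0 i) * ('b_(lift ord0 i) *
    ('a_(lift ord0 i)^-1 * 'b_(lift ord0 i)^-1)))%g.
  by rewrite /w sg_class_comm !mulgA.
have -> : (i.+1 %% m.+1 + m.+1).-1 %% m.+1 = i := congr1 val (ordSK i).
congr (_, _); rewrite /sg_letter /= -3!mulgA -wE.
have -> : ladder i = (w i * ladder i.+1)%g by rewrite ladderS mulVKg.
rewrite invgM mulgA mulgVK.
have [->|i_neq] := eqVneq i ord_max.
  by rewrite modnn ladder0 ladder_max !invgM invgK !mulgA !mulgVK !mulgK.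
have lt_i : i < m by rewrite ltn_neqAle -ltnS ltn_ord andbT.
by rewrite modn_small // mulgK.
Qed.

Lemma coset_act_rev p u :
  foldl coset_act (foldl coset_act p u) (rev_word u) = p.
Proof.
rewrite -foldl_cat.
exact: (foldl_homotopic p coset_actK coset_act_cell (edge_homotopic_revr u)).
Qed.

Lemma coset_act_turns k n : n <= m ->
  foldl coset_act (k, ord0) (nseq n ((ord0, false), false)) = (k, inord n).
Proof.
elim: n => [_|n IH lt_n].
  by congr (_, _); apply: val_inj; rewrite /= inordK.
have -> (x : oedge 2) : nseq n.+1 x = nseq n x ++ [:: x].
  by rewrite -(nseqD n 1) addn1.
rewrite foldl_cat IH 1?ltnW //=.
have -> : (inord n == ord_max :> 'I_m.+1) = false.
  by rewrite -val_eqE /= inordK ?ltn_eqF // ltnS ltnW.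
by congr (_, _); apply: val_inj; rewrite /= !inordK ?modn_small // ltnW.
Qed.

Lemma coset_act_cover_gen e k :
  foldl coset_act (k, ord0) (cover_gen e) = ((k * sg_gen e)%g, ord0).
Proof.
case: e => i b; rewrite /cover_gen /=; case: unliftP => [j|] ->.
  have le_jm : j <= m by rewrite -ltnS.
  have -> (x : oedge 2) : nseq j (rev_oedge x) = rev_word (nseq j x).
    by rewrite /rev_word map_nseq rev_nseq.
  rewrite foldl_cat coset_act_turns // [foldl _ _ (_ :: _)]/= inord_val.
  have := coset_act_rev ((k * sg_gen (lift ord0 j, b))%g, ord0)
    (nseq j ((ord0, false), false)).
  by rewrite coset_act_turns // inord_val.
case: b => [/=|]; first by rewrite ladder0.
(* The first [m] turns only raise the level; the last one wraps around to level 0 and yields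
   [a_0]. *)
have -> (x : oedge 2) : x :: nseq m x = nseq m x ++ [:: x].
  by rewrite -(nseqD m 1) addn1.
rewrite foldl_cat coset_act_turns // (_ : inord m = ord_max) /= ?eqxx.
  by congr (_, _); apply: val_inj; rewrite /= modnn.
by apply: val_inj; rewrite /= inordK.
Qed.

Lemma coset_act_cover_letter x k :
  foldl coset_act (k, ord0) (cover_letter x) = ((k * sg_letter x)%g, ord0).
Proof.
case: x => e [] /=; last exact: coset_act_cover_gen.
rewrite -{1}(mulgVK (sg_gen e) k) -coset_act_cover_gen.
exact: coset_act_rev.
Qed.

Lemma coset_act_cover u k :
  foldl coset_act (k, ord0) (cover_word u) = ((k * sg_class u)%g, ord0).
Proof.
rewrite sg_classE; elim: u k => [|x u IH] k; first by rewrite big_nil mulg1.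
by rewrite foldl_cat coset_act_cover_letter IH big_cons mulgA.
Qed.

Lemma cover_word_inj u :
  edge_homotopic (cover_word u) [::] -> edge_homotopic u [::].
Proof.
move=> /(foldl_homotopic (1%g, ord0) coset_actK coset_act_cell) /=.
by rewrite coset_act_cover mul1g => -[/sg_classP].
Qed.

End CyclicCover.

(** * A free group of integer matrices *)

Local Open Scope ring_scope.

Definition letter : Type := (bool * bool)%type.
HB.instance Definition _ := Finite.on letter.
Definition letterV (l : letter) : letter := (l.1, ~~ l.2).

Definition mx2 (R : Type) (a b c d : R) : 'M[R]_2 :=
  \matrix_(i, j) if i == ord0 then if j == ord0 then a else b
                 else if j == ord0 then c else d.

(* The letters [(false, _)] stand for P and its inverse, [(true, _)] for Q and
   its inverse. *)
Definition letter_mx (l : letter) : 'M[int]_2 :=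
  match l with
  | (false, false) => mx2 2 (-1) (-1) 1
  | (false, true) => mx2 1 1 1 2
  | (true, false) => mx2 2 1 1 1
  | (true, true) => mx2 1 (-1) (-1) 2
  end.

Definition mx_act (R : pzRingType) (A : 'M[R]_2) (v : R * R) : R * R :=
  (A ord0 ord0 * v.1 + A ord0 ord_max * v.2,
   A ord_max ord0 * v.1 + A ord_max ord_max * v.2).

Lemma mx_actM (R : pzRingType) (A B : 'M[R]_2) v :
  mx_act (A * B) v = mx_act A (mx_act B v).
Proof.
have eT (F : 'I_2 -> R) : \sum_i F i = F ord0 + F ord_max.
  by rewrite big_ord_recl big_ord1; congr (_ + F _); exact: val_inj.
by rewrite /mx_act !mxE !eT; congr (_, _);
  rewrite !mulrDl !mulrDr !mulrA addrACA.
Qed.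

Lemma mx_act1 (R : pzRingType) v : mx_act (1 : 'M[R]_2) v = v.
Proof.
by case: v => p q; rewrite /mx_act !mxE /= !mul1r !mul0r addr0 add0r.
Qed.

(* Positive exactly when p/q lies in the open arc of the projective line into
   which the letter pushes the complement of the arc of its inverse. *)
Definition attracting (l : letter) (v : int * int) : int :=
  let: (p, q) := v in
  match l with
  | (false, false) => - ((p + q) * q)
  | (false, true) => p * (q - p)
  | (true, false) => (p - q) * q
  | (true, true) => - (p * (p + q))
  end.

(** An identity of quadratic forms: each letter maps the exterior of the closed arc of its inverse
    onto its own open arc, and end points to end points. *)
Lemma attracting_mobius l v :
  attracting l (mx_act (letter_mx l) v) = - attracting (letterV l) v.
Proof.
by case: l v => [[] []] [p q]; rewrite /mx_act !mxE /=; ring.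
Qed.

Lemma attracting_disjoint l l' v :
  0 < attracting l v -> l != l' -> attracting l' v < 0.
Proof.
case: v => p q.
have := sqr_ge0 p; have := sqr_ge0 q; have := sqr_ge0 (p - q).
have := sqr_ge0 (p + q).
case: l l' => [[] []] [[] []] //= *; nra.
Qed.

Definition reduced : rel letter := [rel x y | y != letterV x].

Local Notation act := (foldl (fun v l => mx_act (letter_mx l) v)).

(** Ping-pong: a letter that does not cancel the previous one moves the point into its own open arc,
    and infinity lies inside no open arc. *)
Lemma attracting_path l w v :
  0 < attracting l v -> path reduced l w -> (act v w).2 != 0.
Proof.
elim: w l v => [|x w IH] l v lv /=.
  move=> _; apply/eqP; case: v lv => p q /= lv q0; move: lv; rewrite q0.
  by case: l => [[] []] /=;
    rewrite ?(mulr0, addr0, subr0, sub0r, oppr0, mulrN, ltxx) //;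
    rewrite oppr_gt0 -expr2 ltNge sqr_ge0.
move=> /andP[lx]; apply: IH; rewrite attracting_mobius oppr_gt0.
apply: attracting_disjoint lv _.
by apply: contraNneq lx => ->; case: x => a b; rewrite /letterV /= negbK.
Qed.

(* The two cycles through the common end points of the arcs, infinity -> -1 ->
   0 -> 1 -> infinity and its reverse; the first letter acts first. *)
Definition corner_loop (s : bool) : seq letter :=
  if s then [:: (true, true); (false, true); (true, false); (false, false)]
  else [:: (false, true); (true, true); (false, false); (true, false)].

(** By ping-pong, a path returning to infinity may not enter the open arc of the letter just
    applied. Starting at infinity, it can only follow arc end points, hence a corner loop, which
    maps [(p, 0)] to [(- p, 0)]. *)
Lemma reduced_fix_infty (p : int) w :
    p != 0 -> sorted reduced w -> (act (p, 0) w).2 = 0 ->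
  w = [::] \/ exists s w', w = corner_loop s ++ w' /\ (act (- p, 0) w').2 = 0.
Proof.
move=> p0; have p2 : 0 < p * p by rewrite -expr2 exprn_even_gt0.
case: w => [|x w]; first by left.
move=> w_red w0; right; move: x w w_red w0.
have mP a b : mx_act (letter_mx (false, false)) (a, b) = (2 * a - b, b - a).
  by rewrite /mx_act !mxE /=; congr (_, _); ring.
have mPV a b : mx_act (letter_mx (false, true)) (a, b) = (a + b, a + 2 * b).
  by rewrite /mx_act !mxE /=; congr (_, _); ring.
have mQ a b : mx_act (letter_mx (true, false)) (a, b) = (2 * a + b, a + b).
  by rewrite /mx_act !mxE /=; congr (_, _); ring.
have mQV a b : mx_act (letter_mx (true, true)) (a, b) = (a - b, 2 * b - a).
  by rewrite /mx_act !mxE /=; congr (_, _); ring.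
pose mE := (mP, mPV, mQ, mQV).
have interior x a b w : path reduced x w -> (act (a, b) w).2 = 0 ->
    attracting x (a, b) <= 0.
  by move=> xw /eqP; apply: contraTT; rewrite -ltNge => /attracting_path; apply.
move=> [[] []] w /=; rewrite mE;
  try by move=> /interior/[apply] /= ?; exfalso; nra.
(* Only the inverses of P and Q lead from infinity to an end point. Each of the next three letters
   is then forced: one choice backtracks, and the other wrong ones enter an open arc. *)
all: do 3! (case: w => [|[[] []] w] /=; [by lia
  | rewrite ?mE; try by [];
    try by move=> /interior/[apply] /= ?; exfalso; nra ..]).
all: set v := (X in act X w); have {v}-> : v = (- p, 0) by congr (_, _); ring.
- by move=> _ w0; exists true, w.
- by move=> _ w0; exists false, w.
Qed.

(** * The stabiliser of infinity *)

Definition word_mx (u : seq letter) : 'M[int]_2 := \prod_(l <- u) letter_mx l.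

Lemma word_mx_cat u v : word_mx (u ++ v) = word_mx u * word_mx v.
Proof. exact: big_cat. Qed.

Definition free_comm : seq letter :=
  [:: (false, false); (true, false); (false, true); (true, true)].

Lemma mulmx2 (R : pzRingType) (a b c d a' b' c' d' : R) :
  mx2 a b c d * mx2 a' b' c' d' =
  mx2 (a * a' + b * c') (a * b' + b * d') (c * a' + d * c') (c * b' + d * d').
Proof.
apply/matrixP => i j; rewrite !mxE big_ord_recl big_ord1 !mxE /=.
by case: (i == ord0); case: (j == ord0).
Qed.

Lemma mx2_1 (R : pzRingType) : mx2 1 0 0 1 = 1 :> 'M[R]_2.
Proof.
apply/matrixP => i j; rewrite !mxE.
by case: i => [[|[|//]] ?]; case: j => [[|[|//]] ?].
Qed.

Lemma letter_mxV l : letter_mx l * letter_mx (letterV l) = 1.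
Proof. by rewrite -mx2_1; case: l => [[] []]; rewrite mulmx2; congr mx2. Qed.

Lemma letterVK : involutive letterV.
Proof. by case=> b s; rewrite /letterV /= negbK. Qed.

Lemma not_sortedP (T : Type) (e : rel T) w : ~~ sorted e w ->
  exists w1 x y w2, w = w1 ++ [:: x, y & w2] /\ ~~ e x y.
Proof.
elim: w => [|x [|y w] IH] //=; rewrite negb_and => /orP[xy|].
  by exists [::], x, y, w.
by move=> /IH [w1 [x' [y' [w2 [-> xy]]]]]; exists (x :: w1), x', y', w2.
Qed.

Lemma mx_act_word_mx u v : mx_act (word_mx u) v = act v (rev u).
Proof.
rewrite foldl_rev; elim: u => [|l u IH].
  by rewrite /word_mx big_nil mx_act1.
by rewrite /word_mx big_cons mx_actM IH.
Qed.

(** Induction on the length: a backtrack is cancelled, and a reduced word sheds a corner loop, which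
    is [free_comm] or its inverse. The same steps are valid in [G], where only the inverse relations
    are known. Two exponents avoid negative powers, and [p] varies because a corner loop changes its
    sign. *)
Lemma stab_infty (G : groupType) (h : letter -> G) u (p : int) :
    (forall l, h l * h (letterV l) = 1)%g ->
    p != 0 -> (mx_act (word_mx u) (p, 0)).2 = 0 ->
  let c := (\prod_(l <- free_comm) h l)%g in
  exists i j, word_mx u * word_mx free_comm ^+ j = word_mx free_comm ^+ i /\
              ((\prod_(l <- u) h l) * c ^+ j = c ^+ i)%g.
Proof.
move=> hV p0 u0 c; have [n le_n] := ubnP (size u).
elim: n => // n IH in u p p0 u0 le_n *.
have [w_red|/not_sortedP[w1 [l [l' [w2 []]]]]] :=
    boolP (sorted reduced (rev u)); last first.
  rewrite negbK => + /eqP l'_eq; rewrite {}l'_eq => /(canRL revK) u_eq.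
  pose u' := rev w2 ++ rev w1.
  have hu : (\prod_(l <- u) h l = \prod_(l <- u') h l)%g.
    rewrite u_eq -(cat1s l) -(cat1s (letterV l)) !rev_cat -!catA !big_cat /=.
    rewrite !big_cons !big_nil !mulg1 (mulgA (h _)).
    by rewrite -{2}(letterVK l) hV mul1g.
  have Nu : word_mx u = word_mx u'.
    rewrite u_eq -(cat1s l) -(cat1s (letterV l)) !rev_cat -!catA !word_mx_cat.
    rewrite /word_mx !big_cons !big_nil !mulr1 (mulrA (letter_mx _)).
    by rewrite -{2}(letterVK l) letter_mxV mul1r.
  rewrite hu Nu; apply: IH p0 _ _; first by rewrite -Nu.
  by move: le_n; rewrite u_eq size_rev !size_cat /= !size_rev; lia.
move: u0; rewrite mx_act_word_mx => u0.
have [|[s [w' [w_eq w0]]]] := reduced_fix_infty p0 w_red u0.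
  move/(canRL revK) => ->; exists 0%N, 0%N.
  by rewrite /word_mx !big_nil !expr0 mulr1 expg0 mulg1.
have u_eq : u = rev w' ++ rev (corner_loop s) by rewrite -rev_cat -w_eq revK.
have [|||i [j [Nij hij]]] := IH (rev w') (- p).
- by rewrite oppr_eq0.
- by rewrite mx_act_word_mx revK.
- by move: le_n; rewrite u_eq size_cat; case: (s) => /=; lia.
rewrite u_eq word_mx_cat big_cat /=; case: s {w_eq u_eq}.
  exists i.+1, j; rewrite (_ : rev (corner_loop true) = free_comm) // -/c.
  rewrite -mulrA -exprS exprSr mulrA Nij -exprSr; split => //.
  by rewrite -mulgA -expgS expgSr mulgA hij -expgSr.
exists i, j.+1; rewrite exprS expgS -mulrA -mulgA.
set w1 := rev (corner_loop false).
have -> : word_mx w1 * (word_mx free_comm * word_mx free_comm ^+ j) =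
    word_mx free_comm ^+ j.
  rewrite mulrA -word_mx_cat (_ : word_mx _ = 1) ?mul1r //.
  by rewrite /word_mx /= !big_cons big_nil mulr1 !mulmx2 -mx2_1; congr mx2.
have -> : ((\prod_(l <- w1) h l) * (c * c ^+ j) = c ^+ j)%g.
  rewrite mulgA -big_cat /= !big_cons big_nil mulg1 !mulgA.
  have hV' a b : (h (a, b) * h (a, ~~ b) = 1)%g := hV (a, b).
  have hVx x a b : (x * h (a, b) * h (a, ~~ b) = x)%g.
    by rewrite -mulgA hV' mulg1.
  rewrite (hVx _ false true) (hVx _ true true) (hVx _ false false).
  by rewrite (hV' true false) mul1g.
by [].
Qed.

Lemma word_mx_comm : word_mx free_comm = mx2 (-1) 6 0 (-1).
Proof. by rewrite /word_mx !big_cons big_nil mulr1 !mulmx2; congr mx2. Qed.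

Lemma word_mx_comm_inj i j :
  word_mx free_comm ^+ i = word_mx free_comm ^+ j -> i = j.
Proof.
have E k : word_mx free_comm ^+ k =
    mx2 ((-1) ^+ k) (- (-1) ^+ k * 6 * k%:R) 0 ((-1) ^+ k).
  elim: k => [|k IH]; first by rewrite !expr0 mulr0 mx2_1.
  by rewrite exprS IH word_mx_comm mulmx2 exprS; congr mx2; ring.
rewrite !E => /matrixP eq_ij.
have := eq_ij ord0 ord0; have := eq_ij ord0 ord_max; rewrite !mxE /= => + e.
rewrite e => /mulfI.
have e0 : (-1) ^+ j != 0 :> int by rewrite expf_neq0.
by rewrite mulf_neq0 ?oppr_eq0 // => /(_ isT)/eqP; rewrite eqr_nat => /eqP.
Qed.

(** * A faithful representation of the genus two surface group *)

Definition shear (i : 'I_2) (f : {poly int}) : 'M[{poly int}]_2 :=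
  if i == ord0 then 1 else mx2 1 f 0 1.

(* The roles of a and b are exchanged in the second factor, so that both copies
   of the commutator [free_comm] are the same element of the surface group. *)
Definition embed_letter (i : 'I_2) (l : letter) : oedge 2 :=
  ((i, l.1 (+) (i != ord0)), l.2).

Definition rho (x : oedge 2) : 'M[{poly int}]_2 :=
  let i := x.1.1 in
  shear i 'X * map_mx polyC (letter_mx (x.1.2 (+) (i != ord0), x.2))
    * shear i (- 'X).

Lemma map_mx2 (R S : Type) (f : R -> S) a b c d :
  map_mx f (mx2 a b c d) = mx2 (f a) (f b) (f c) (f d).
Proof.
by apply/matrixP => i j; rewrite !mxE; case: (i == _); case: (j == _).
Qed.

Lemma shearVK i : shear i (- 'X) * shear i 'X = 1.
Proof.
rewrite /shear; case: ifP => _; first exact: mulr1.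
by rewrite mulmx2 -mx2_1; congr mx2; ring.
Qed.

Lemma shearK i : shear i 'X * shear i (- 'X) = 1.
Proof.
rewrite /shear; case: ifP => _; first exact: mulr1.
by rewrite mulmx2 -mx2_1; congr mx2; ring.
Qed.

Lemma rho_embed_letter i l : rho (embed_letter i l) =
  shear i 'X * map_mx polyC (letter_mx l) * shear i (- 'X).
Proof.
by case: l => b s; rewrite /rho [_.1.1]/= [_.1.2]/= -addbA addbb addbF.
Qed.

Lemma rho_embed i u :
  \prod_(x <- map (embed_letter i) u) rho x =
  shear i 'X * map_mx polyC (word_mx u) * shear i (- 'X).
Proof.
rewrite /word_mx; elim: u => [|l u IH].
  by rewrite !big_nil map_mx1 mulr1 shearK.
rewrite !big_cons IH map_mxM rho_embed_letter.
by rewrite -!mulrA (mulrA (shear i (- _))) shearVK mul1r !mulrA.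
Qed.

Lemma embed_letter_surj x : exists i l, x = embed_letter i l.
Proof.
case: x => [[i b] s]; exists i, (b (+) (i != ord0), s).
by rewrite /embed_letter /= -addbA addbb addbF.
Qed.

Lemma rhoK x : rho x * rho (rev_oedge x) = 1.
Proof.
have [i [l ->]] := embed_letter_surj x.
have -> : rev_oedge (embed_letter i l) = embed_letter i (letterV l) by [].
rewrite !rho_embed_letter -!mulrA (mulrA (shear i (- _))) shearVK mul1r.
rewrite (mulrA (map_mx _ _)) (_ : map_mx _ _ * _ = 1) ?mul1r ?shearK //.
by rewrite -[LHS]map_mxM [_ *m _]letter_mxV map_mx1.
Qed.

(** The shear commutes with the upper triangular matrix of [free_comm], and the exchange of [a] and
    [b] makes the second handle contribute the inverse of the first. *)
Lemma rho_cell : \prod_(x <- cell_boundary 2) rho x = 1.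
Proof.
rewrite cell_boundary2 big_cat /=.
have -> : comm_word ord0 = map (embed_letter ord0) free_comm by [].
have -> : comm_word ord_max = map (embed_letter ord_max)
  [:: (true, false); (false, false); (true, true); (false, true)] by [].
rewrite !rho_embed word_mx_comm /word_mx !big_cons big_nil mulr1 !mulmx2.
rewrite !map_mx2 /shear /= mul1r mulr1 !mulmx2 -mx2_1.
congr mx2; ring.
Qed.

Lemma rho_homotopic u v : edge_homotopic u v ->
  \prod_(x <- u) rho x = \prod_(x <- v) rho x.
Proof. by apply: prodr_homotopic; [exact: rhoK | exact: rho_cell]. Qed.

(** * Syllables and ping-pong for the degree *)

Definition syllable : Type := ('I_2 * seq letter)%type.

Definition syllable_word (t : syllable) : seq (oedge 2) :=
  map (embed_letter t.1) t.2.

Definition syllables_word (s : seq syllable) : seq (oedge 2) :=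
  flatten (map syllable_word s).

Lemma mx_act_map_mx (A : 'M[int]_2) (p q : {poly int}) :
  mx_act (map_mx polyC A) (p, q) =
  ((A ord0 ord0)%:P * p + (A ord0 ord_max)%:P * q,
   (A ord_max ord0)%:P * p + (A ord_max ord_max)%:P * q).
Proof. by rewrite /mx_act !mxE. Qed.

(* Up to the shear of the factor [i], the pair (p, q) is a point p/q of the
   projective line over Q(t), of positive or infinite degree for [near_infty],
   of degree at most 0 for [near_base]. *)
Definition near_infty i (v : {poly int} * {poly int}) :=
  (size (mx_act (shear i (- 'X)) v).2 < size (mx_act (shear i (- 'X)) v).1)%N.

Definition near_base i (v : {poly int} * {poly int}) :=
  (size (mx_act (shear i (- 'X)) v).1 <= size (mx_act (shear i (- 'X)) v).2)%N
    && ((mx_act (shear i (- 'X)) v).2 != 0).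

Definition moves_infty (t : syllable) : bool := word_mx t.2 ord_max ord0 != 0.

(** The lower left entry is a nonzero constant and the numerator has the larger degree, so the new
    denominator has exactly the degree of the old numerator. *)
Lemma mx_act_syllable t v : moves_infty t -> near_infty t.1 v ->
  near_base t.1 (mx_act (\prod_(x <- syllable_word t) rho x) v).
Proof.
rewrite /moves_infty /near_infty /near_base /syllable_word rho_embed.
rewrite -!mx_actM !mulrA shearVK mul1r mx_actM.
case: (mx_act _ v) => p q g0 lt_qp; rewrite mx_act_map_mx.
move: g0 lt_qp; rewrite [(p, q).1]/= [(p, q).2]/=.
move: (word_mx t.2) => A g0 lt_qp; rewrite /=.
have sC (c : int) (f : {poly int}) : (size (c%:P * f)%R <= size f)%N.
  by rewrite mul_polyC size_scale_leq.
have sp : size ((A ord_max ord0)%:P * p +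
    (A ord_max ord_max)%:P * q) = size p.
  have gp : size ((A ord_max ord0)%:P * p) = size p.
    by rewrite mul_polyC size_scale.
  by rewrite size_polyDl gp // (leq_ltn_trans (sC _ _)).
rewrite -size_poly_gt0 sp (leq_ltn_trans _ lt_qp) // andbT.
rewrite (leq_trans (size_polyD _ _)) // geq_max sC /=.
by rewrite (leq_trans (sC _ _)) // ltnW.
Qed.

(** Changing to the coordinates of the other factor adds ['X] or [- 'X] to a quotient of degree at
    most 0. *)
Lemma near_base_infty i j v : i != j -> near_base i v -> near_infty j v.
Proof.
rewrite /near_base /near_infty => ij.
have {ij} : (i == ord0) = (j != ord0).
  by move: ij; case: i => [[|[|//]] ?]; case: j => [[|[|//]] ?].
have size_shear (f p q : {poly int}) : size f = 2%N -> (size p <= size q)%N ->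
    q != 0 -> (size q < size (p + f * q)%R)%N.
  move=> sf le_pq q0; have f0 : f != 0 by rewrite -size_poly_gt0 sf.
  have sfq : size (f * q) = (size q).+1 by rewrite size_mul ?sf.
  by rewrite addrC size_polyDl sfq // ltnS.
case: v => p q; rewrite /shear; case: (i == ord0); case: (j == ord0) => //= _;
  rewrite ?mx_act1 /mx_act !mxE /= !mul1r !mul0r !(add0r, addr0) => /andP[].
- by apply: size_shear; rewrite size_polyN size_polyX.
- move=> le_pq q0; rewrite -[p](subrK ('X * q)) -mulNr.
  by apply: size_shear; rewrite ?size_polyX.
Qed.

Lemma sg_class_embed i u :
  sg_class (map (embed_letter i) u) =
  (\prod_(l <- u) sg_letter (embed_letter i l))%g.
Proof. by rewrite sg_classE big_map. Qed.

Lemma sg_class_embed_comm i : sg_class (map (embed_letter i) free_comm) =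
  sg_class (comm_word ord0) :> surface_group 2.
Proof.
have -> : i = if i == ord0 then ord0 else ord_max.
  by apply/val_inj; case: i => [[|[|//]] ?].
case: (i == ord0) => //.
have := sg_class_cell 2; rewrite cell_boundary2 sg_class_cat.
move=> /mulg1_eq/(canRL (@invgK _)).
rewrite !sg_class_comm => ->.
rewrite sg_class_embed !big_cons big_nil mulg1 /sg_letter /=.
by rewrite !invgM !invgK !mulgA.
Qed.

Lemma stab_infty_embed i u : word_mx u ord_max ord0 = 0 ->
  exists a b, word_mx u * word_mx free_comm ^+ b = word_mx free_comm ^+ a /\
    (sg_class (map (embed_letter i) u) * sg_class (comm_word ord0) ^+ b =
     sg_class (comm_word ord0) ^+ a)%g.
Proof.
move=> u0; rewrite sg_class_embed -(sg_class_embed_comm i) sg_class_embed.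
apply: (@stab_infty _ (fun l => sg_letter (embed_letter i l)) u 1) => // [l|].
  by rewrite (sg_letterV (embed_letter i l)) mulgV.
by rewrite /mx_act /= u0 mul0r mulr0 addr0.
Qed.

(** A syllable fixing infinity lies in the cyclic subgroup along which the two free groups are
    amalgamated, so it can be rewritten in either factor. *)
Lemma embed_transfer i j u : word_mx u ord_max ord0 = 0 ->
  exists v,
    sg_class (map (embed_letter j) v) = sg_class (map (embed_letter i) u).
Proof.
move=> /(stab_infty_embed i)[a [b [_ /(canRL (mulgK _)) ->]]].
have pow k w : sg_class (map (embed_letter j) (flatten (nseq k w))) =
    (sg_class (map (embed_letter j) w) ^+ k)%g.
  by elim: k => [|k IH] //=; rewrite map_cat sg_class_cat IH expgS.
exists (flatten (nseq a free_comm) ++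
        flatten (nseq b (rev (map letterV free_comm)))).
rewrite map_cat sg_class_cat !pow sg_class_embed_comm -expVgn map_rev -map_comp.
rewrite -(sg_class_embed_comm j) -sg_class_rev /rev_word -map_comp.
by congr (_ ^+ _ * sg_class (rev _) ^+ _)%g; exact: sg_class_embed_comm.
Qed.

(** A trivial matrix fixes infinity, so the class is a power of the commutator; the exponent
    vanishes because the matrix of [free_comm] has infinite order. *)
Lemma syllable_faithful t :
  \prod_(x <- syllable_word t) rho x = 1 -> sg_class (syllable_word t) = 1%g.
Proof.
rewrite rho_embed => t1.
have {}t1 : map_mx polyC (word_mx t.2) = 1.
  rewrite -[LHS]mul1r -[LHS]mulr1 -(shearVK t.1) -!mulrA.
  by rewrite (mulrA (shear _ 'X)) (mulrA (_ * _)) t1 mul1r shearVK.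
have {}t1 : word_mx t.2 = 1.
  move: t1; rewrite -[1 in RHS](map_mx1 polyC) => /matrixP t1.
  by apply/matrixP => i j; have := t1 i j; rewrite !mxE => /polyC_inj.
have [|a [b []]] := @stab_infty_embed t.1 t.2; first by rewrite t1 !mxE.
rewrite t1 mul1r => /word_mx_comm_inj ->.
by rewrite -[RHS]mul1g => /mulIg.
Qed.

Definition alternating : rel syllable :=
  [rel t t' | [&& t.1 != t'.1, moves_infty t & moves_infty t']].

Lemma syllables_word_cat s s' :
  syllables_word (s ++ s') = syllables_word s ++ syllables_word s'.
Proof. by rewrite /syllables_word map_cat flatten_cat. Qed.

(** Either both syllables use the same factor, or one lies in the amalgamated subgroup and passes to
    the other factor. A decomposition with fewest syllables is therefore alternating. *)
Lemma merge_syllables t t' : ~~ alternating t t' ->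
  exists t'',
    sg_class (syllable_word t'') = sg_class (syllables_word [:: t; t']).
Proof.
rewrite /syllables_word /= cats0 sg_class_cat.
rewrite !negb_and !negbK => /or3P[/eqP eq_i|/eqP|/eqP].
- exists (t.1, t.2 ++ t'.2).
  by rewrite {1}/syllable_word map_cat sg_class_cat /= [in X in (_ * X)%g]eq_i.
- move=> /(embed_transfer t.1 t'.1)[v v_t]; exists (t'.1, v ++ t'.2).
  by rewrite {1}/syllable_word map_cat sg_class_cat /= v_t.
- move=> /(embed_transfer t'.1 t.1)[v v_t]; exists (t.1, t.2 ++ v).
  by rewrite {1}/syllable_word map_cat sg_class_cat /= v_t.
Qed.

Lemma alternating_near_base t s : moves_infty t -> path alternating t s ->
  near_base t.1 (mx_act (\prod_(x <- syllables_word (t :: s)) rho x) (1, 0)).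
Proof.
rewrite /syllables_word /=; elim: s t => [|t' s IH] t t_inf /=.
  rewrite cats0 => _; apply: mx_act_syllable => //.
  rewrite /near_infty /shear; case: ifP => _.
    by rewrite mx_act1 size_poly0 size_poly1.
  rewrite /mx_act !mxE /= !mul1r !mul0r !mulr0 !addr0.
  by rewrite size_poly0 size_poly1.
case/andP=> /and3P[tt' _ t'_inf] /(IH _ t'_inf) base.
rewrite big_cat mx_actM /=; apply: mx_act_syllable => //.
by apply: near_base_infty base; rewrite eq_sym.
Qed.

Lemma rho_faithful u : \prod_(x <- u) rho x = 1 -> edge_homotopic u [::].
Proof.
move=> u1; apply/sg_classP; rewrite sg_class_nil.
have [s s_u s_min] : exists2 s, sg_class (syllables_word s) = sg_class u &
    forall s', sg_class (syllables_word s') = sg_class u ->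
      (size s <= size s')%N.
  pose P n :=
    `[< exists2 s, size s = n & sg_class (syllables_word s) = sg_class u >].
  have exP : exists n, P n.
    have [s s_u] : exists s, syllables_word s = u.
      elim: (u) => [|x v [s <-]]; first by exists [::].
      by have [i [l ->]] := embed_letter_surj x; exists ((i, [:: l]) :: s).
    by exists (size s); apply/asboolP; exists s => //; rewrite s_u.
  have [n /asboolP[s <- s_u] n_min] := ex_minnP exP.
  by exists s => // s' s'_u; apply: n_min; apply/asboolP; exists s'.
have rho_s : \prod_(x <- syllables_word s) rho x = 1.
  by rewrite (@rho_homotopic _ u) //; apply/sg_classP.
have s_alt : sorted alternating s.
  apply: contraT => /not_sortedP[s1 [t [t' [s2 [s_eq]]]]].
  move=> /merge_syllables[t'' t''E].
  have := s_min (s1 ++ t'' :: s2); rewrite s_eq !size_cat /= !addnS ltnn; apply.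
  have mid r : sg_class (syllables_word (s1 ++ r ++ s2)) =
      (sg_class (syllables_word s1) * sg_class (syllables_word r) *
       sg_class (syllables_word s2))%g.
    by rewrite !syllables_word_cat !sg_class_cat mulgA.
  rewrite -s_u s_eq (mid [:: t'']) (mid [:: t; t']) -t''E.
  by rewrite /syllables_word /= cats0.
(* A single syllable may fix infinity and is treated apart. Two or more alternating ones send
   infinity to a point satisfying [near_base], whereas the identity fixes infinity. *)
rewrite -s_u; case: s => [|t [|t' s]] // in s_alt rho_s {s_min s_u} *.
  by move: rho_s; rewrite /syllables_word /= cats0; exact: syllable_faithful.
have t_inf : moves_infty t by case/andP: s_alt => /and3P[].
have := alternating_near_base t_inf s_alt.
rewrite rho_s mx_act1 /near_base /shear; case: ifP => _.
  by rewrite mx_act1 /= size_poly0 size_poly1.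
by rewrite /mx_act !mxE /= !mul1r !mul0r !mulr0 !addr0 size_poly0 size_poly1.
Qed.

(** * Reduction to finite quotients *)

(** Such majorants pass to sums and products; their value at 1 bounds coefficients, and their value
    at [t >= 0] bounds values. *)
Definition dominated (p q : {poly int}) : Prop := forall i, `|p`_i| <= q`_i.

Lemma dominated_ge0 p q i : dominated p q -> 0 <= q`_i.
Proof. by move/(_ i); exact: le_trans. Qed.

Lemma dominatedD p q p' q' :
  dominated p q -> dominated p' q' -> dominated (p + p') (q + q').
Proof.
by move=> pq pq' i; rewrite !coefD (le_trans (ler_normD _ _)) // lerD.
Qed.

Lemma dominatedN p q : dominated p q -> dominated (- p) q.
Proof. by move=> pq i; rewrite coefN normrN. Qed.

Lemma dominatedM p q p' q' :
  dominated p q -> dominated p' q' -> dominated (p * p') (q * q').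
Proof.
move=> pq pq' i; rewrite !coefM (le_trans (ler_norm_sum _ _ _)) //.
by apply: ler_sum => j _; rewrite normrM ler_pM.
Qed.

Lemma dominated_bool (b : bool) : dominated b%:R 1.
Proof.
by move=> [|i]; case: b; rewrite ?mulr1n ?mulr0n !(coef0, coef1).
Qed.

Lemma dominated_horner p q (t : int) :
  dominated p q -> 0 <= t -> `|p.[t]| <= q.[t].
Proof.
move=> pq t0; pose n := maxn (size p) (size q).
rewrite (@horner_coef_wide _ n) ?leq_maxl //.
rewrite (@horner_coef_wide _ n q) ?leq_maxr //.
rewrite (le_trans (ler_norm_sum _ _ _)) //; apply: ler_sum => i _.
by rewrite normrM (ger0_norm (exprn_ge0 _ t0)) ler_wpM2r // exprn_ge0.
Qed.

Lemma dominated_coef p q i : dominated p q -> `|p`_i| <= q.[1].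
Proof.
move=> pq; rewrite (le_trans (pq i)) // horner_coef.
have q0 j : 0 <= q`_j := dominated_ge0 j pq.
have [lt_iq|ge_iq] := ltnP i (size q).
  rewrite (bigD1 (Ordinal lt_iq)) //= expr1n mulr1 lerDl sumr_ge0 // => j _.
  by rewrite expr1n mulr1.
by rewrite nth_default // sumr_ge0 // => j _; rewrite expr1n mulr1.
Qed.

Lemma horner_le_expr p q (t : int) :
  dominated p q -> 1 <= t -> q.[t] <= q.[1] * t ^+ size q.
Proof.
move=> pq t1; rewrite !horner_coef mulr_suml; apply: ler_sum => i _.
rewrite expr1n mulr1 ler_wpM2l ?(dominated_ge0 _ pq) //.
by rewrite ler_weXn2l // ltnW.
Qed.

(* If c is the lowest nonzero coefficient, [p.[t] = 0] forces t to divide c. *)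
Lemma horner_neq0 (p : {poly int}) (t : int) :
  (forall i, `|p`_i| < t) -> p.[t] = 0 -> p = 0.
Proof.
elim/poly_ind: p => // p c IH coef_lt.
rewrite hornerD hornerMX hornerC => pt0.
have t0 : 0 < t by rewrite (le_lt_trans _ (coef_lt 0%N)).
have c0 : c = 0.
  have := coef_lt 0%N; rewrite coefD coefMX coefC add0r /= => c_lt.
  have t_c : (t %| c)%Z.
    by rewrite -(addr0_eq pt0) -mulNr dvdz_mull.
  apply/eqP; apply: contraTT c_lt => c_neq0; rewrite -leNgt.
  rewrite -(gtr0_norm t0) -!abszE lez_nat; apply: dvdn_leq t_c.
  by rewrite absz_gt0.
move: pt0; rewrite c0 addr0 => /eqP.
rewrite mulf_eq0 (gt_eqF t0) orbF => /eqP pt0.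
rewrite (IH _ pt0) ?mul0r ?add0r // => i.
by have := coef_lt i.+1; rewrite coefD coefMX coefC addr0.
Qed.

Lemma intr_Zp_eq0 m (z : int) : `|z| < m%:Z -> (1 < m)%N ->
  z%:~R = 0 :> 'Z_m -> z = 0.
Proof.
move=> z_lt m_gt1.
have nat_eq0 (n : nat) : (n < m)%N -> n%:R = 0 :> 'Z_m -> n = 0%N.
  by move=> lt_nm /(congr1 val); rewrite /= val_Zp_nat // modn_small.
case: z z_lt => n; rewrite ?NegzE ?normrN => n_lt.
  by move=> /nat_eq0 ->.
by rewrite mulrNz => /eqP; rewrite oppr_eq0 => /eqP/nat_eq0; case/(_ n_lt).
Qed.

Lemma dominated_fin (I : finType) (F : I -> {poly int}) :
  exists Q, dominated 1 Q /\ forall i, dominated (F i) Q.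
Proof.
pose absp (p : {poly int}) := \poly_(k < size p) `|p`_k|.
have abspE p : dominated p (absp p).
  move=> k; rewrite coef_poly; case: ltnP => // ge_k.
  by rewrite nth_default // normr0.
have sum_ge0 k (P : pred I) : 0 <= (\sum_(i | P i) absp (F i))`_k.
  by rewrite coef_sum sumr_ge0 // => i _; exact: dominated_ge0 (abspE _).
have one_ge0 k : 0 <= (1 : {poly int})`_k.
  exact: dominated_ge0 (dominated_bool true).
exists (1 + \sum_i absp (F i)); split=> [k|i k]; rewrite coefD.
  by rewrite (le_trans (dominated_bool true k)) // lerDl sum_ge0.
rewrite (bigD1 i) //= coefD (le_trans (abspE _ k)) //.
by rewrite addrCA lerDl addr_ge0.
Qed.

(** Each entry of a product of two 2 by 2 matrices has two terms, whence a factor [Q + Q] per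
    letter. *)
Lemma dominated_prod g (theta : oedge g -> 'M[{poly int}]_2) Q u i j :
    (forall x i j, dominated (theta x i j) Q) ->
  dominated ((\prod_(x <- u) theta x) i j) ((Q + Q) ^+ size u).
Proof.
move=> thetaQ; elim: u i j => [|x u IH] i j.
  by rewrite big_nil mxE expr0; exact: dominated_bool.
rewrite big_cons mxE big_ord_recl big_ord1 /= exprS mulrDl.
by apply: dominatedD; apply: dominatedM.
Qed.

Definition word_separates g n (T : pzRingType) (psi : oedge g -> T) : Prop :=
  (forall u v, edge_homotopic u v ->
     \prod_(x <- u) psi x = \prod_(x <- v) psi x) /\
  (forall u, (size u < n)%N ->
     \prod_(x <- u) psi x = 1 -> edge_homotopic u [::]).

Lemma separating_reduction g (theta : oedge g -> 'M[{poly int}]_2) :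
    (forall n, word_separates n theta) ->
  exists s b : nat, (1 < s)%N /\ forall n, (1 < n)%N ->
    exists m, [/\ (1 < m)%N, (m <= s ^ (b * n ^ 2))%N &
      exists psi : oedge g -> 'M['Z_m]_2, word_separates n psi].
Proof.
move=> theta_sep.
have [Q [Q1 thetaQ']] := dominated_fin
  (fun t : oedge g * 'I_2 * 'I_2 => theta t.1.1 t.1.2 t.2).
have thetaQ x i j : dominated (theta x i j) Q := thetaQ' (x, i, j).
pose S := Q + Q; pose s := `|S.[1]|%N; pose d := size S.
have Q_ge1 t : 0 <= t -> 1 <= Q.[t].
  by move=> t0; have := dominated_horner Q1 t0; rewrite hornerC.
have S_ge2 t : 0 <= t -> 2 <= S.[t].
  by move=> /Q_ge1 ?; rewrite hornerD; lra.
have sE : s%:Z = S.[1] by rewrite abszE ger0_norm // (le_trans _ (S_ge2 _ _)).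
have s_gt1 : (1 < s)%N by rewrite -ltz_nat sE (lt_le_trans _ (S_ge2 _ _)).
have SS : dominated 1 S.
  by move=> i; rewrite coefD (le_trans (Q1 i)) // lerDl (dominated_ge0 _ Q1).
(* The bound obtained is [s ^ (2 + (1 + (n + 2) * d) * n)], and this exponent is at most
   [(2 + 2 * d) * n ^ 2] for [n >= 2]. *)
exists s, (2 + 2 * d)%N; split=> // n n_gt1.
(* For words shorter than [n], the entries minus those of the identity have coefficients at most
   [s ^ n + 1] and values at [t] at most [(s * t ^ d) ^ n + 1]; [t] and [m] are one larger. *)
pose t := (s ^ n + 2)%N; pose m := ((s * t ^ d) ^ n + 2)%N.
exists m; split; first by rewrite /m addn2.
  have add2 x : (0 < x)%N -> (x + 2 <= s ^ 2 * x)%N by nia.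
  have exp_mono x y k : (x <= y)%N -> (x ^ k <= y ^ k)%N.
    by case: k => // k; rewrite leq_exp2r.
  have s_gt0 : (0 < s)%N by rewrite ltnW.
  have t_gt0 : (0 < t)%N by rewrite /t addn2.
  have t_le : (t <= s ^ (n + 2))%N.
    by rewrite addnC expnD add2 // expn_gt0 s_gt0.
  have st_gt0 : (0 < (s * t ^ d) ^ n)%N.
    by rewrite expn_gt0 muln_gt0 s_gt0 expn_gt0 t_gt0.
  rewrite (leq_trans (add2 _ st_gt0)) //.
  apply: (@leq_trans (s ^ (2 + (1 + (n + 2) * d) * n))).
    rewrite expnD leq_mul2l expnM exp_mono ?orbT //.
    by rewrite expnD expn1 leq_mul2l expnM exp_mono ?orbT.
  rewrite leq_pexp2l //; nia.
pose psi x : 'M['Z_m]_2 :=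
  map_mx (fun p : {poly int} => (p.[t%:Z])%:~R) (theta x).
have psiE u : \prod_(x <- u) psi x =
    map_mx (fun p : {poly int} => (p.[t%:Z])%:~R) (\prod_(x <- u) theta x).
  elim: u => [|x u IH].
    rewrite !big_nil; apply/matrixP => i j; rewrite !mxE.
    by case: (i == j); rewrite ?hornerC.
  rewrite !big_cons IH; apply/matrixP => i j; rewrite !mxE.
  rewrite horner_sum rmorph_sum; apply: eq_bigr => k _.
  by rewrite !mxE hornerM rmorphM.
exists psi; split=> [u v uv|u lt_un u1].
  by rewrite !psiE; congr map_mx; have [/(_ u v uv)] := theta_sep n.
have [_] := theta_sep n; apply=> //; apply/matrixP => i j.
set M := \prod_(x <- u) _; apply/eqP; rewrite -subr_eq0; apply/eqP.
have M_dom : dominated (M i j - (1 : 'M[{poly int}]_2) i j) (S ^+ size u + 1).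
  apply: dominatedD; first exact: dominated_prod.
  by rewrite mxE; apply/dominatedN/dominated_bool.
have S_pow z : 0 <= z -> (S ^+ size u + 1).[z] <= S.[z] ^+ n + 1.
  move=> z0; rewrite hornerD hornerC horner_exp lerD2r.
  by rewrite ler_weXn2l ?(ltnW lt_un) // (le_trans _ (S_ge2 _ z0)).
apply: (@horner_neq0 _ t%:Z) => [k|].
  rewrite (le_lt_trans (dominated_coef k M_dom)) //.
  rewrite (le_lt_trans (S_pow _ _)) //.
  by rewrite -sE /t; lia.
apply: (@intr_Zp_eq0 m).
- rewrite (le_lt_trans (dominated_horner M_dom _)) //.
  rewrite (le_lt_trans (S_pow _ _)) //.
  have St : S.[t%:Z] <= s%:Z * t%:Z ^+ d.
    by rewrite sE; apply: horner_le_expr SS _; rewrite /t; lia.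
  have mE : m%:Z = (s%:Z * t%:Z ^+ d) ^+ n + 2.
    by rewrite /m -!natz natrD natrX natrM natrX.
  rewrite mE ler_ltD // ler_pXn2r ?(ltnW n_gt1) // nnegrE.
    by rewrite (le_trans _ (S_ge2 _ _)).
  by rewrite mulr_ge0 // exprn_ge0.
- by rewrite /m addn2.
rewrite hornerD hornerN rmorphD rmorphN /=.
move: u1; rewrite psiE => /matrixP/(_ i j); rewrite mxE => ->.
by rewrite !mxE; case: (i == j); rewrite ?hornerC ?subrr.
Qed.

(** * Kernels of finite representations and the index bound *)

Lemma finite_index_kernel g n (T : finNzRingType) (psi : oedge g -> T) :
  word_separates n psi ->
  exists (H : {pred surface_group g}) (f : nat),
    [/\ normal_subgroup H, index_eq H f, (f <= #|T|)%N &
        forall x, x \in H -> x <> 1%g -> ~~ (word_length x < n)%N].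
Proof.
move=> [psi_hom psi_inj].
pose E (x : surface_group g) : T := \prod_(y <- repr x) psi y.
have EE u : E (sg_class u) = \prod_(y <- u) psi y.
  exact: psi_hom (edge_homotopic_repr u).
have EM x y : E (x * y)%g = E x * E y.
  rewrite -(sg_class_surj x) -(sg_class_surj y) -sg_class_cat !EE.
  by rewrite big_cat.
have E1 : E 1%g = 1 by rewrite -sg_class_nil EE big_nil.
have EV x : E x^-1%g * E x = 1 by rewrite -EM mulVg.
pose H : {pred surface_group g} := [pred x | E x == 1].
have EH x : (x \in H) = (E x == 1) by [].
have HV x : x \in H -> x^-1%g \in H.
  by rewrite !EH => /eqP x1; rewrite -(EV x) x1 mulr1.
pose S : {set T} := [set y | `[< exists x, E x = y >]].
exists H, #|S|; split; last 2 first.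
- exact: max_card.
- move=> x; rewrite EH => xH x1; apply/negP => lt_n; apply: x1.
  move: lt_n; rewrite /word_length.
  case: ex_minnP => k /asboolP[u <- ux] _ lt_n.
  rewrite -ux word_evalE -sg_class_nil; apply/sg_classP; apply: psi_inj lt_n _.
  by rewrite -EE -word_evalE ux; apply/eqP.
- split; first split; first by rewrite EH E1.
    move=> x y xH /HV yH; move: xH yH; rewrite !EH EM.
    by move=> /eqP-> /eqP->; rewrite mulr1.
  move=> x xH y; rewrite EH conjgE !EM; move: xH; rewrite EH => /eqP->.
  by rewrite mul1r EV.
(* The cosets of the kernel are the fibres of [E], so the index is the size of its image [S]. *)
have HE x z : E z = E x <-> ([set (x * h)%g | h in [set` H]] z)%classic.
  split=> [zx|[h /= hH <-]]; last first.
    by move: hH; rewrite EM EH => /eqP->; rewrite mulr1.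
  exists (x^-1 * z)%g; last exact: mulVKg.
  by rewrite /= EH EM zx EV.
pose coset (k : 'I_#|S|) : set (surface_group g) :=
  [set z | E z = enum_val k]%classic.
have S_E x : E x \in S by rewrite inE; apply/asboolP; exists x.
have E_S (k : 'I_#|S|) : exists x, E x = enum_val k.
  by have := enum_valP k; rewrite inE => /asboolP.
rewrite /index_eq.
have -> : left_cosets H =
    [set coset k | k in [set: 'I_#|S|]]%classic.
  apply/seteqP; split=> [_ [x _ <-]|_ [k _ <-]].
    exists (enum_rank_in (S_E x) (E x)) => //; apply/seteqP.
    by split=> z; rewrite /coset /= enum_rankK_in // => /HE.
  have [x xk] := E_S k; exists x => //; apply/seteqP.
  by split=> z; rewrite /coset /= -xk => /HE.
apply: (@card_eq_trans _ _ _ _ [set: 'I_#|S|]%classic); last first.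
  by rewrite card_eq_sym; exact: card_II.
apply: inj_card_eq => k k' _ _ kk'; have [x xk] := E_S k.
by apply: enum_val_inj; rewrite -xk; have : coset k' x by rewrite -kk'.
Qed.

(** The [m.+1]-fold cyclic cover of the genus two surface has genus [m.+2], so [rho] restricts to a
    faithful representation, which separates words of every length. *)
Lemma surface_group_linear m :
  exists theta : oedge m.+2 -> 'M[{poly int}]_2,
    forall n, word_separates n theta.
Proof.
exists (fun x => \prod_(y <- cover_letter x) rho y) => n.
have thetaE u : \prod_(x <- u) \prod_(y <- cover_letter x) rho y =
    \prod_(y <- cover_word u) rho y by rewrite big_flatten big_map.
split=> [u v uv|u _]; rewrite !thetaE.
  exact/rho_homotopic/cover_word_homotopic.
by move=> /rho_faithful; exact: cover_word_inj.
Qed.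

Theorem theorem6p23 (R : realType) (g : nat) (hg : (2 <= g)%N) :
  exists (H : nat -> {pred surface_group g}) (f : nat -> nat),
    (forall n : nat, (1 < n)%N ->
       [/\ normal_subgroup (H n),
           index_eq (H n) (f n) &
           forall x : surface_group g,
             x \in H n -> x <> 1%g -> ~~ (word_length x < n)%N]) /\
    (exists A B : R,
       [/\ (0 < A)%R, (0 < B)%R &
           forall n : nat, (1 < n)%N ->
             ((f n)%:R <= A * (g%:R `^ (B * n%:R ^+ 2)))%R]).
Proof.
case: g hg => [|[|m]] // _.
have [theta theta_sep] := surface_group_linear m.
have [s [b [s_gt1 reduction]]] := separating_reduction theta_sep.
(* The exponent 4 is the number of entries of a 2 by 2 matrix. *)
pose good n (Hf : {pred surface_group m.+2} * nat) := (1 < n)%N ->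
  [/\ normal_subgroup Hf.1, index_eq Hf.1 Hf.2,
      (Hf.2 <= (s ^ (b * n ^ 2)) ^ 4)%N &
      forall x, x \in Hf.1 -> x <> 1%g -> ~~ (word_length x < n)%N].
have /choice[Hf HfP] : forall n, exists Hf, good n Hf.
  move=> n; case: (ltnP 1 n) => [n_gt1|n_le1]; last first.
    (* A dummy value, since nothing is claimed for [n <= 1]. *)
    exists ([pred _ | false] : {pred _}, 0%N) => n_gt1.
    by rewrite ltnNge n_le1 in n_gt1.
  have [k [k_gt1 k_le [psi psi_sep]]] := reduction n n_gt1.
  have [H [f [H_normal H_index f_le H_sep]]] := finite_index_kernel psi_sep.
  exists (H, f) => _; split=> //=; rewrite (leq_trans f_le) //.
  rewrite card_mx card_ord Zp_cast //.
  by rewrite leq_exp2r.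
exists (fun n => (Hf n).1), (fun n => (Hf n).2); split.
  by move=> n /HfP[].
(* The base [s] is replaced by the genus through [s <= m.+2 ^ s]; the successor keeps [B] positive
   even if [b = 0]. *)
exists 1, (s * b * 4).+1%:R; split=> // n n_gt1.
have [_ _ f_le _] := HfP n n_gt1.
rewrite mul1r -natrX -natrM powR_mulrn // -natrX ler_nat (leq_trans f_le) //.
have s_le : (s <= m.+2 ^ s)%N by rewrite ltnW // ltn_expl.
rewrite -expnM (@leq_trans ((m.+2 ^ s) ^ (b * n ^ 2 * 4))) //.
  by case: (_ * 4)%N => // k; rewrite leq_exp2r.
by rewrite -expnM leq_pexp2l //; nia.
Qed.
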